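(* For every real $z\ge\frac14$ and every real $t$ with $|t|<1$, $$\sum_{n=0}^\infty g_n(z)\,t^n=\frac{1}{1-z^{-\frac12}t+t^2}.$$
   Context: For each integer $n\ge 0$ and real $z>0$, $g_n(z)=\sum_{k=0}^{\lfloor n/2\rfloor}(-1)^k\binom{n-k}{k}z^{k-\frac n2}$. *)

(* Defs.v *)
From HB Require Import structures.
From mathcomp Require Import all_boot all_order all_algebra.
From mathcomp Require Import all_classical all_reals all_analysis.
Set Implicit Arguments.
Unset Strict Implicit.
Unset Printing Implicit Defensive.
Import Order.TTheory GRing.Theory Num.Theory.
Import numFieldNormedType.Exports.
Local Open Scope classical_set_scope.
Local Open Scope ring_scope.

(* Only meant for z > 0, where the exponent k - n/2 may be negative and
   half-integral; [n./2] is the floor of n/2, and [n - k] does not truncate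
   because k <= n./2. *)
Definition g (R : realType) (n : nat) (z : R) : R :=
  \sum_(k < n./2.+1) (-1) ^+ k * 'C(n - k, k)%:R * z `^ (k%:R - n%:R / 2).

(* Main.v *)
(** Write [a = z^(-1/2)], so that [0 < a <= 2].  Pascal's rule gives
    [g_(n+2) = a g_(n+1) - g_n], hence the partial sums of the series multiplied
    by [1 - a t + t^2] telescope to [1 - g_(n+1) t^(n+1) + g_n t^(n+2)].  The
    recurrence preserves the quadratic form
    [g_n^2 - a g_n g_(n+1) + g_(n+1)^2 = 1]; completing the square gives
    [|g_(n+1) - (a/2) g_n| <= 1], so [|g_n| <= n + 1] and the remainder tends
    to 0. *)
Require Import Defs.
From HB Require Import structures.
From mathcomp Require Import all_boot all_order all_algebra.
From mathcomp Require Import all_classical all_reals all_analysis.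
From mathcomp Require Import ring lra zify.
Set Implicit Arguments.
Unset Strict Implicit.
Unset Printing Implicit Defensive.
Import Order.TTheory GRing.Theory Num.Theory.
Import numFieldNormedType.Exports.
Local Open Scope classical_set_scope.
Local Open Scope ring_scope.

(** For [k > n./2] the truncated [n - k] is below [k], so the added binomials vanish. This lets sums
    for different [n] share a range. *)
Lemma g_widen (R : realType) (z : R) (n m : nat) : (n./2 < m)%N ->
  g n z =
  \sum_(k < m) (-1) ^+ k * 'C(n - k, k)%:R * z `^ (k%:R - n%:R / 2).
Proof.
move=> nm; rewrite /g.
rewrite (big_ord_widen m
  (fun k => (-1) ^+ k * 'C(n - k, k)%:R * z `^ (k%:R - n%:R / 2))) //.
rewrite [RHS](bigID (fun k : 'I_m => (k < n./2.+1)%N)) /=.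
rewrite [X in _ = _ + X]big1 ?addr0// => k nk.
by rewrite bin_small ?mulr0 ?mul0r//; lia.
Qed.

Lemma g0 (R : realType) (z : R) : g 0 z = 1.
Proof. by rewrite /g big_ord1 /= bin0 mul0r subrr powRr0 !mulr1. Qed.

Lemma g1 (R : realType) (z : R) : g 1 z = z `^ (- (1 / 2)).
Proof. by rewrite /g big_ord1 /= bin0 sub0r !mul1r. Qed.

Lemma g_rec (R : realType) (z : R) (n : nat) : 0 < z ->
  g n.+2 z = z `^ (- (1 / 2)) * g n.+1 z - g n z.
Proof.
move=> z0.
(* Once the [k = 0] terms of the two longer sums are split off, all three sums run over [n.+2]
   indices. *)
rewrite (@g_widen _ _ n.+2 n.+3) ?(@g_widen _ _ n.+1 n.+3)
  ?(@g_widen _ _ n n.+2); [|lia..].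
have powa (x : R) : z `^ (- (1 / 2)) * z `^ x = z `^ (x - 1 / 2).
  by rewrite -powRD ?(gt_eqF z0) ?implybT// addrC.
rewrite mulr_sumr big_ord_recl [in RHS]big_ord_recl -addrA -sumrB.
congr +%R.
  rewrite mulrCA powa /= !subn0 !bin0 !expr0 !mul1r; congr (_ `^ _).
  by rewrite -!natr1; field.
apply: eq_bigr => j _ /=.
rewrite /bump /= !add1n !subSS [X in _ = X - _]mulrCA powa.
have -> : j.+1%:R - n.+1%:R / 2 - 1 / 2 = j%:R - n%:R / 2 :> R.
  by rewrite -!natr1; field.
have -> : j.+1%:R - n.+2%:R / 2 = j%:R - n%:R / 2 :> R.
  by rewrite -!natr1; field.
(* Pascal's rule; for [j > n] the subtractions truncate to 0 and all three binomials are 0. *)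
have -> : 'C(n.+1 - j, j.+1) = ('C(n - j, j.+1) + 'C(n - j, j))%N.
  have [jn|nj] := leqP j n; first by rewrite subSn// binS.
  by rewrite !bin_small//; lia.
by rewrite natrD exprS; ring.
Qed.

Section LinearRecurrence.
Variables (R : realType) (a : R) (u : nat -> R).
Hypotheses (u0 : u 0 = 1) (u1 : u 1 = a).
Hypothesis uSS : forall n, u n.+2 = a * u n.+1 - u n.

(** Consecutive forms differ by [(u n.+2 - u n) * (u n.+2 + u n - a * u n.+1)], whose second factor
    is 0. *)
Lemma rec_invariant n : u n ^+ 2 - a * u n * u n.+1 + u n.+1 ^+ 2 = 1.
Proof.
elim: n => [|n IH]; first by rewrite u0 u1; ring.
by rewrite -IH uSS; ring.
Qed.

(** Here [u n] is the Chebyshev polynomial of the second kind at [a / 2]; the bound is attained at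
    [a = 2]. *)
Lemma rec_bound n : `|a| <= 2 -> `|u n| <= n.+1%:R.
Proof.
move=> a2; elim: n => [|n IH]; first by rewrite u0 normr1.
have a24 : a ^+ 2 <= 4.
  by rewrite -real_normK ?num_real//; have := normr_ge0 a; nra.
(* By the invariant, the square of the left side is [1 - (1 - a ^+ 2 / 4) * u n ^+ 2]. *)
have h : `|u n.+1 - a / 2 * u n| <= 1.
  rewrite -(@ler_sqr R) ?nnegrE// real_normK ?num_real//.
  have := rec_invariant n.
  have : 0 <= (4 - a ^+ 2) * u n ^+ 2 by rewrite mulr_ge0 ?sqr_ge0 ?subr_ge0.
  by nra.
have -> : u n.+1 = (u n.+1 - a / 2 * u n) + a / 2 * u n by ring.
rewrite (le_trans (ler_normD _ _))// -[n.+2%:R]natr1 [leRHS]addrC lerD//.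
rewrite normrM (le_trans _ IH)// ler_piMl//.
by rewrite normrM [`|2^-1|]ger0_norm//; lra.
Qed.

Lemma rec_series t n :
  (1 - a * t + t ^+ 2) * series (fun k => u k * t ^+ k) n.+1 =
  1 - u n.+1 * t ^+ n.+1 + u n * t ^+ n.+2.
Proof.
elim: n => [|n IH]; first by rewrite /series /= big_nat1 u0 u1; ring.
by rewrite seriesSr mulrDr IH uSS !exprS; ring.
Qed.

End LinearRecurrence.

(** Split [|t| ^+ n] as [s ^+ n * s ^+ n] with [s] the square root of [|t|]: one factor absorbs
    [n.+1], the other decays. *)
Lemma cvg_natM_expr0 (R : realType) (t : R) : `|t| < 1 ->
  (fun n => n.+1%:R * `|t| ^+ n) @ \oo --> 0.
Proof.
move=> t1; pose s := Num.sqrt `|t|.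
have s0 : 0 <= s by exact: sqrtr_ge0.
have st : s ^+ 2 = `|t| by rewrite sqr_sqrtr.
have s1 : s < 1 by nra.
(* The geometric sum of [n + 1] terms, each at least [s^n], is below
   [1 / (1 - s)]. *)
have bnd n : n.+1%:R * s ^+ n <= (1 - s)^-1.
  rewrite -[leRHS]mul1r ler_pdivlMr ?subr_gt0//.
  have : n.+1%:R * s ^+ n <= \sum_(i < n.+1) s ^+ i.
    rewrite mulr_natl -[in leLHS](card_ord n.+1) -sumr_const.
    by apply: ler_sum => i _; rewrite ler_wiXn2l ?(ltW s1)// -ltnS.
  have := subrX1 s n.+1; have : 0 <= s ^+ n.+1 by rewrite exprn_ge0.
  by nra.
have sn0 : (fun n => (1 - s)^-1 * s ^+ n) @ \oo --> 0.
  rewrite -[X in _ --> X](mulr0 (1 - s)^-1).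
  by apply: cvgMr; apply: cvg_expr; rewrite ger0_norm.
apply: (squeeze_cvgr _ (@cvg_cst _ 0 _ _ _) sn0).
near=> n; rewrite mulr_ge0 ?exprn_ge0//=.
by rewrite -st -exprM mulnC exprM expr2 mulrA ler_wpM2r ?exprn_ge0.
Unshelve. all: by end_near. Qed.

Theorem proposition8 (R : realType) (z t : R) (hz : 1 / 4 <= z)
    (ht : `|t| < 1) :
  series (fun n : nat => g n z * t ^+ n) @ \oo
    --> 1 / (1 - z `^ (- (1 / 2)) * t + t ^+ 2).
Proof.
have z0 : 0 < z by lra.
set a := z `^ (- (1 / 2)).
have a0 : 0 < a by exact: powR_gt0.
have a2z : a ^+ 2 * z = 1.
  rewrite -powR_mulrn ?(ltW a0)// -powRrM.
  have -> : - (1 / 2) * 2%:R = -1 :> R by field.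
  by rewrite powR_inv1 ?(ltW z0)// mulVf ?gt_eqF.
have a2 : `|a| <= 2 by rewrite gtr0_norm//; nra.
have gr n : g n.+2 z = a * g n.+1 z - g n z by exact: g_rec.
(* Since [a * t <= 2 * |t|], the denominator is at least [(1 - |t|) ^+ 2]. *)
have D0 : 0 < 1 - a * t + t ^+ 2.
  have : a * t <= 2 * `|t|.
    by rewrite (le_trans (ler_norm _))// normrM ler_wpM2r.
  have : 0 < (1 - `|t|) ^+ 2 by rewrite exprn_gt0// subr_gt0.
  by rewrite sqrrB real_normK ?num_real//; lra.
have gt0 : (fun n => g n z * t ^+ n) @ \oo --> 0.
  apply/norm_cvg0P; apply: (squeeze_cvgr _ (@cvg_cst _ 0 _ _ _)
    (cvg_natM_expr0 ht)).
  near=> n; rewrite normr_ge0/= normrM normrX ler_wpM2r ?exprn_ge0//.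
  exact: (rec_bound (g0 z) (g1 z) gr).
have -> : 1 / (1 - a * t + t ^+ 2) = (1 - 0 + 0 * t ^+ 2) / (1 - a * t + t ^+ 2).
  by rewrite subr0 mul0r addr0.
(* The closed form is available for the partial sums of length [n.+1], hence the shift. *)
rewrite -cvg_shiftS.
have -> : (fun n => series (fun k => g k z * t ^+ k) n.+1) =
    (fun n => (1 - g n.+1 z * t ^+ n.+1 + g n z * t ^+ n * t ^+ 2) /
      (1 - a * t + t ^+ 2)).
  apply/funext => n; have := rec_series (g0 z) (g1 z) gr t n.
  by move=> h; rewrite -mulrA -exprD addn2 -h mulrC mulKf ?gt_eqF.
apply: cvgMl; apply: cvgD; last exact: cvgMl.
apply: cvgB; first exact: cvg_cst.
by rewrite (cvg_shiftS (fun n => g n z * t ^+ n)).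
Unshelve. all: by end_near. Qed.
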